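(* Multivariate integration in $C^\infty([0,1]^d)$ is not strongly tractable; that is, there is no polynomial $p$ in one variable such that $n(\varepsilon,B_d)\le p(\varepsilon^{-1})$ for all $\varepsilon\in(0,1)$ and all positive integers $d$.
   Context: For a positive integer $d$, let $F_d = C^\infty([0,1]^d)$ be the space of real functions defined on the unit cube $[0,1]^d$ that are infinitely differentiable, with the norm $$\|f\|_d=\sup\{|D^{\alpha}f(x)| : x\in[0,1]^d,\ \alpha \text{ any multiindex}\},$$ where $\alpha=[\alpha_1,\ldots,\alpha_d]$ has non-negative integer entries (including $\alpha=0$), $|\alpha|=\alpha_1+\cdots+\alpha_d$, and $D^\alpha f=\frac{\partial^{|\alpha|}}{\partial x_1^{\alpha_1}\cdots\partial x_d^{\alpha_d}}f$. Let $B_d$ denote the unit ball of this space, i.e. the set of infinitely differentiable $f:[0,1]^d\to\mathbb{R}$ with $\|f\|_d\le 1$. For $f\in B_d$ let $I_d(f)=\int_{[0,1]^d} f(t)\,dt$ (Lebesgue measure). A linear algorithm using $n$ function values is a map $A_{n,d}(f)=\sum_{j=1}^n a_j f(x_j)$ with real coefficients $a_1,\ldots,a_n$ and sample points $x_1,\ldots,x_n\in[0,1]^d$. Its worst case error is $\mathrm{err}(A_{n,d})=\sup\{|I_d(f)-A_{n,d}(f)| : f\in B_d\}$. For $\varepsilon\in(0,1)$, $n(\varepsilon,B_d)$ is the minimal number $n$ of function values needed to approximate the integral of any $f\in B_d$ with error at most $\varepsilon$, i.e. the minimal $n$ for which there is a linear algorithm $A_{n,d}$ using $n$ function values with $\mathrm{err}(A_{n,d})\le\varepsilon$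 (with $n(\varepsilon,B_d)=\infty$ if no such $n$ exists). The problem is called strongly tractable if $n(\varepsilon,B_d)$ is bounded by a polynomial in $\varepsilon^{-1}$ that does not depend on $d$. *)

(* Defs.v *)
From HB Require Import structures.
From mathcomp Require Import all_boot all_order all_algebra.
From mathcomp Require Import all_classical all_reals all_analysis.
Set Implicit Arguments.
Unset Strict Implicit.
Unset Printing Implicit Defensive.
Import Order.TTheory GRing.Theory Num.Theory.
Import numFieldNormedType.Exports.
Local Open Scope classical_set_scope.
Local Open Scope ring_scope.

Lemma product_sigma_finite d1 d2 (T1 : measurableType d1)
    (T2 : measurableType d2) (R : realType)
    (m1 : {sigma_finite_measure set T1 -> \bar R})
    (m2 : {sigma_finite_measure set T2 -> \bar R}) :
  sigma_finite [set: T1 * T2] (m1 \x m2)%E.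
Proof.
have /sigma_finiteP[F [TF ndF Foo]] := sigma_finiteT m1.
have /sigma_finiteP[G [TG ndG Goo]] := sigma_finiteT m2.
exists (fun n => F n `*` G n).
  rewrite -setXTT TF TG predeqE => -[x y]; split.
    move=> [/= [n _ Fnx] [k _ Gky]]; exists (maxn n k) => //; split.
    - by move: x Fnx; exact/subsetPset/ndF/leq_maxl.
    - by move: y Gky; exact/subsetPset/ndG/leq_maxr.
  by move=> [n _ []/= ? ?]; split; exists n.
move=> k; have [? ?] := Foo k; have [? ?] := Goo k.
split; first exact: measurableX.
by rewrite product_measure1E// lte_mul_pinfty// ge0_fin_numE.
Qed.

Section tuple_measure.
Context d (T : measurableType d) (R : realType).

Definition tuple_cons n (p : T * n.-tuple T) : n.+1.-tuple T :=
  [tuple of p.1 :: p.2].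

Definition tuple_uncons n (t : n.+1.-tuple T) : T * n.-tuple T :=
  (thead t, [tuple of behead t]).

Lemma measurable_tuple_cons n : measurable_fun [set: _] (@tuple_cons n).
Proof. exact: measurable_cons. Qed.

Lemma measurable_tuple_uncons n : measurable_fun [set: _] (@tuple_uncons n).
Proof.
apply: measurable_fun_pair; first exact: measurable_tnth.
exact: measurable_behead.
Qed.

Lemma tuple_consK n : cancel (@tuple_cons n) (@tuple_uncons n).
Proof. by case=> x t; congr pair; apply: val_inj. Qed.

Section cons.
Variables (n : nat) (mu : {sigma_finite_measure set T -> \bar R}).
Variable nu : {sigma_finite_measure set (n.-tuple T) -> \bar R}.

(* product of [mu] and [nu], carried over to [n.+1.-tuple T] *)
Definition measure_cons : set (n.+1.-tuple T) -> \bar R :=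
  pushforward (mu \x nu)%E (@tuple_cons n).

Let measure_cons0 : measure_cons set0 = 0%E.
Proof. by rewrite /measure_cons /pushforward preimage_set0 measure0. Qed.

Let measure_cons_ge0 A : (0 <= measure_cons A)%E.
Proof.
by rewrite /measure_cons /pushforward; exact: (measure_ge0 (mu \x nu)%E).
Qed.

Let measure_cons_sigma_additive : semi_sigma_additive measure_cons.
Proof.
have mc := @measurable_tuple_cons n.
move=> F mF tF mUF; rewrite /measure_cons /pushforward preimage_bigcup.
apply: measure_semi_sigma_additive.
- by move=> k; rewrite -[X in measurable X]setTI; exact: mc.
- apply/trivIsetP => /= i j _ _ ij; rewrite -preimage_setI.
  by move/trivIsetP : tF => /(_ _ _ _ _ ij) ->//; rewrite preimage_set0.
- by rewrite -preimage_bigcup -[X in measurable X]setTI; exact: mc.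
Qed.

HB.instance Definition _ := isMeasure.Build _ _ _ measure_cons
  measure_cons0 measure_cons_ge0 measure_cons_sigma_additive.

Let measure_cons_sigma_finite : sigma_finite [set: _] measure_cons.
Proof.
have [F TF mF] := product_sigma_finite mu nu.
exists (fun k => @tuple_uncons n @^-1` F k).
  by rewrite -preimage_bigcup -TF preimage_setT.
move=> k; have [mFk Fk] := mF k; split.
  by rewrite -[X in measurable X]setTI; exact: measurable_tuple_uncons.
rewrite /measure_cons /pushforward -comp_preimage.
rewrite (_ : _ \o _ = id) ?preimage_id//.
by apply/funext => p /=; rewrite tuple_consK.
Qed.

HB.instance Definition _ := Measure_isSigmaFinite.Build _ _ _ measure_cons
  measure_cons_sigma_finite.

End cons.

Let dirac_sigma_finite : sigma_finite [set: _]
  (dirac [tuple] : {measure set (0.-tuple T) -> \bar R}).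
Proof.
exists (fun=> setT); first by rewrite bigcup_const//; exists 0%N.
by move=> _; split => //; rewrite /= diracT ltry.
Qed.

HB.instance Definition _ := Measure_isSigmaFinite.Build _ _ _
  (dirac [tuple] : set (0.-tuple T) -> \bar R) dirac_sigma_finite.

(* n-fold product measure; the 0-fold product is the unit mass at [[tuple]] *)
Fixpoint tuple_measure (mu : {sigma_finite_measure set T -> \bar R}) n :
    {sigma_finite_measure set (n.-tuple T) -> \bar R} :=
  if n is m.+1 then measure_cons mu (tuple_measure mu m)
  else (dirac [tuple] : set (0.-tuple T) -> \bar R).

End tuple_measure.

(* Integration in C^oo([0,1]^d), with points of R^d as row vectors. *)
Section multivariate_integration.
Variable R : realType.

Definition unit_cube d : set 'rV[R]_d :=
  [set x | forall i, x ord0 i \in `[0, 1]].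

Section derivatives.
Variable d : nat.
Implicit Types (f : 'rV[R]_d -> R) (x : 'rV[R]_d) (i : 'I_d).

(* Functions on the cube are represented by total functions on R^d of which
   only the values on the cube are used. Accordingly, the increments [h] of
   the difference quotients keep the point inside the cube: derivatives are
   one-sided at the faces of the cube and two-sided in its interior. *)
Definition difference_quotient i f x (h : R) : R :=
  h^-1 * (f (x + h *: delta_mx ord0 i) - f x).

Definition increments i x : set_system R :=
  within [set h | unit_cube (x + h *: delta_mx ord0 i)] 0^'.

Definition has_partial i f x : Prop :=
  cvg (difference_quotient i f x @ increments i x).

Definition partial i f x : R :=
  lim (difference_quotient i f x @ increments i x).

(* [iter_partial [:: i1; ...; ik] f] is the derivative of [f] with respect to
   [x_ik], then ..., then [x_i1]. *)
Definition iter_partial (s : seq 'I_d) f : 'rV[R]_d -> R := foldr partial f s.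

Definition multi_partial (alpha : 'I_d -> nat) f : 'rV[R]_d -> R :=
  iter_partial (flatten [seq nseq (alpha i) i | i <- enum 'I_d]) f.

Definition smooth_on_cube f : Prop :=
  forall s : seq 'I_d,
    {within @unit_cube d, continuous (iter_partial s f)} /\
    (forall i x, unit_cube x -> has_partial i (iter_partial s f) x).

Definition smooth_norm f : \bar R :=
  ereal_sup [set `|multi_partial alpha f x|%:E
            | alpha in [set: 'I_d -> nat] & x in @unit_cube d].

Definition unit_ball : set ('rV[R]_d -> R) :=
  [set f | smooth_on_cube f /\ (smooth_norm f <= 1)%E].

End derivatives.

(* d-dimensional Lebesgue measure, on the Borel sets of [d.-tuple R] *)
Definition lebesgue_tuple d :=
  tuple_measure (@lebesgue_measure R) d.

Definition row_of_tuple d (t : d.-tuple (measurableTypeR R)) : 'rV[R]_d :=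
  \row_i tnth t i.

Definition cube_integral d (f : 'rV[R]_d -> R) : R :=
  \int[lebesgue_tuple d]_(t in @row_of_tuple d @^-1` @unit_cube d)
    f (row_of_tuple t).

Definition linear_algorithm d n (a : 'I_n -> R) (x : 'I_n -> 'rV[R]_d)
  (f : 'rV[R]_d -> R) : R := \sum_(j < n) a j * f (x j).

Definition worst_case_error d (A : ('rV[R]_d -> R) -> R) : \bar R :=
  ereal_sup [set `|cube_integral f - A f|%:E | f in @unit_ball d].

(* A nonempty set of natural numbers has a minimum, so the infimum is attained;
   it is [+oo] when no algorithm has error at most [eps]. *)
Definition complexity (eps : R) d : \bar R :=
  ereal_inf [set n%:R%:E | n in
    [set n : nat | exists (a : 'I_n -> R) (x : 'I_n -> 'rV[R]_d),
      (forall j, unit_cube (x j)) /\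
      (worst_case_error (linear_algorithm a x) <= eps%:E)%E]].

Definition strongly_tractable : Prop :=
  exists p : {poly R}, forall (eps : R) (d : nat), 0 < eps < 1 -> (0 < d)%N ->
    (complexity eps d <= p.[eps^-1]%:E)%E.

End multivariate_integration.

(* Main.v *)
Require Import Defs.
From HB Require Import structures.
From mathcomp Require Import all_boot all_order all_algebra.
From mathcomp Require Import lra ring.
From mathcomp Require Import all_classical all_reals all_analysis.
From mathcomp Require Import measurable_realfun.
Set Implicit Arguments.
Unset Strict Implicit.
Unset Printing Implicit Defensive.
Import Order.TTheory GRing.Theory Num.Theory.
Import numFieldNormedType.Exports.
Local Open Scope classical_set_scope.
Local Open Scope ring_scope.

(** Strong tractability already fails at the fixed accuracy 1/96: the number of
nodes needed there is unbounded in the dimension d.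

Let an algorithm with nodes x_1, ..., x_n and weights a_1, ..., a_n have error
at most 1/96 on the unit ball, and apply it to the products x_i x_k / 2 of two
coordinates, which belong to the unit ball ([unit_ball_half_product]). The
matrix of entries M_ik = sum_j a_j (x_j)_i (x_j)_k is then within 1/48 of the
matrix of second moments of the cube, with 1/3 on the diagonal and 1/4
elsewhere ([second_moment_error]). Hence two distinct rows i and j of M differ
by at least 1/24 in column i: the d rows of M are separated in the sup norm.

On the other hand M is a sum of n matrices of rank one, so its rows lie in a
space of dimension at most n, and they are bounded by 1. A bounded set in a
space of dimension n has boundedly many points at mutual distance more than
1/48, with a bound that does not depend on the ambient dimension d
([near_equal_rows]). If n stayed below p(96) for all d, this would bound d.

Arguing by the rank of M, rather than by a test function that is small at the
nodes, is what copes with weights a_j of arbitrary size. *)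

(** * Separated rows of a bounded matrix of small rank *)

(** The eliminated matrix vanishes in column [k0], whereas row [i0] of [M] does
not; hence its row space is a proper subspace of that of [M]. *)
Lemma mxrank_eliminate (F : fieldType) m n (M : 'M[F]_(m, n)) i0 k0 :
  M i0 k0 != 0 ->
  (\rank (M - (M i0 k0)^-1 *: (col k0 M *m row i0 M))%R < \rank M)%N.
Proof.
move=> Mn0; set E := M - _.
have EM : (E <= M)%MS.
  rewrite addmx_sub// -scaleN1r scalemx_sub// scalemx_sub//.
  by rewrite mulmx_sub// row_sub.
apply: rank_ltmx; rewrite ltmxE EM /=; apply/negP => ME.
have /submxP[w /matrixP/(_ ord0 k0)] := submx_trans (row_sub i0 M) ME.
rewrite [LHS]mxE mxE big1 => [M0|l _]; first by rewrite M0 eqxx in Mn0.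
rewrite !mxE big_ord1 !mxE mulrCA mulVf// mulr1 subrr mulr0 //.
Qed.

Lemma pigeonhole_set m n (A : {set 'I_m}) (c : 'I_m -> 'I_n) K :
  (n * K < #|A|)%N -> exists j, (K < #|[set i in A | c i == j]|)%N.
Proof.
move=> KA; apply/existsP.
rewrite -[X in is_true X]negbK negb_exists; apply/negP => /forallP small.
move: KA; rewrite ltnNge => /negP; apply.
rewrite -sum1_card (partition_big c xpredT)//=.
apply: (@leq_trans (\sum_(j < n) K)%N); last by rewrite sum_nat_const card_ord.
apply: leq_sum => j _; rewrite sum1dep_card leqNgt.
apply: contra (small j) => h.
by apply: leq_trans h _; apply: eq_leq; apply: eq_card => i; rewrite !inE.
Qed.


(** A packing bound in dimension [r] that is uniform in the size of the matrix,
by induction on the rank. Eliminating with a pivot of maximal absolute value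
keeps the multipliers of all rows in [-1, 1] and at most doubles the entries.
The pigeonhole principle gives many rows with nearly equal multipliers; two of
them that are close after elimination are close in [M] itself. *)
Lemma near_equal_rows (R : realType) r (B e : R) : 0 < e ->
  exists K, forall m n (M : 'M[R]_(m, n)) (A : {set 'I_m}),
    (\rank M <= r)%N -> (forall i k, `|M i k| <= B) -> (K < #|A|)%N ->
    exists i j, [/\ i \in A, j \in A, i != j &
      forall k, `|M i k - M j k| <= e].
Proof.
elim: r B e => [|r IH] B e e0.
  exists 1%N => m n M A; rewrite leqn0 mxrank_eq0 => /eqP -> _ /card_gt1P.
  move=> [i [j [iA jA ij]]]; exists i, j; split=> // k.
  by rewrite !mxE subrr normr0 ltW.
have e20 : 0 < e / 2 by rewrite divr_gt0.
have [K HK] := IH (2 * B) (e / 2) e20.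
(* Multipliers within 1 / N change a row by at most B / N <= e / 2. *)
set N := (Num.truncn (2 * B / e)).+1.
have BN : B <= N%:R * (e / 2).
  have := truncnS_gt (2 * B / e); rewrite -/N ltr_pdivrMr// => /ltW; lra.
exists ((2 * N).+1 * K).+1 => m n M A rM MB KA.
have [M0|] := eqVneq M 0.
  have /card_gt1P[i [j [iA jA ij]]] : (1 < #|A|)%N by apply: leq_trans KA.
  exists i, j; split=> // k.
  by rewrite M0 !mxE subrr normr0 ltW.
move=> /matrix0Pn[i1 [k1 M1]].
have [[i0 k0] M0 Mmax] : exists2 p, M p.1 p.2 != 0 &
    forall i k, `|M i k| <= `|M p.1 p.2|.
  case: (@arg_maxP _ _ _ (i1, k1) xpredT (fun p => `|M p.1 p.2|)) => //.
  move=> p _ pmax; exists p; last by move=> i k; exact: (pmax (i, k)).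
  rewrite -normr_gt0; apply: lt_le_trans (pmax (i1, k1) _) => //.
  by rewrite normr_gt0.
rewrite /= in M0 Mmax.
pose lam i := M i k0 / M i0 k0.
have lam1 i : `|lam i| <= 1.
  by rewrite normrM normfV ler_pdivrMr ?normr_gt0// mul1r.
pose E : 'M[R]_(m, n) := M - (M i0 k0)^-1 *: (col k0 M *m row i0 M).
have EE i k : E i k = M i k - lam i * M i0 k.
  by rewrite !mxE big_ord1 !mxE /lam; ring.
have rE : (\rank E <= r)%N.
  by rewrite -ltnS; apply: leq_trans rM; exact: mxrank_eliminate.
have EB i k : `|E i k| <= 2 * B.
  rewrite EE (le_trans (ler_normB _ _))// mulr_natl mulr2n lerD// normrM.
  by rewrite -[leRHS]mul1r ler_pM.
pose cell i : 'I_(2 * N).+1 := inord (Num.truncn ((lam i + 1) * N%:R)).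
have lamN i : 0 <= (lam i + 1) * N%:R <= (2 * N)%:R.
  have := lam1 i; rewrite ler_norml => /andP[l1 l2].
  by rewrite natrM mulr_ge0 ?ler_wpM2r//=; lra.
have cellE i : cell i = Num.truncn ((lam i + 1) * N%:R) :> nat.
  have /andP[l1 l2] := lamN i.
  rewrite inordK// ltnS -(ler_nat R); apply: le_trans l2.
  by rewrite truncn_le.
have [j Kj] := pigeonhole_set cell (ltnW KA).
have [i [i' [iA i'A ii' close]]] := HK _ _ E _ rE EB Kj.
move: iA i'A; rewrite !inE => /andP[iA /eqP ci] /andP[i'A /eqP ci'].
exists i, i'; split=> // k.
have lamii' : `|lam i - lam i'| * N%:R <= 1.
  have /andP[/truncn_itv/andP[a1 a2] _] := lamN i.
  have /andP[/truncn_itv/andP[b1 b2] _] := lamN i'.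
  move: a1 a2 b1 b2; rewrite -!cellE ci ci' -natr1 => a1 a2 b1 b2.
  rewrite -[X in _ * X]ger0_norm// -normrM ler_norml; apply/andP; split; lra.
have -> : M i k - M i' k = (E i k - E i' k) + (lam i - lam i') * M i0 k.
  by rewrite !EE; ring.
rewrite (splitr e) (le_trans (ler_normD _ _))// lerD// normrM.
apply: (@le_trans _ _ (`|lam i - lam i'| * (N%:R * (e / 2)))).
  by rewrite ler_wpM2l// (le_trans (MB _ _)).
by rewrite (mulrA _ N%:R); apply: ler_piMl => //; exact: ltW.
Qed.

(** * Second moments of the unit cube *)

Lemma measurable_tuple_prod d (T : measurableType d) (R : realType) n
    (g : 'I_n -> T -> R) : (forall i, measurable_fun setT (g i)) ->
  measurable_fun [set: n.-tuple T] (fun t => \prod_(i < n) g i (tnth t i)).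
Proof.
move=> mg; apply: measurable_prod => i _.
by apply: measurableT_comp => //; exact: measurable_tnth.
Qed.

(** Tonelli's theorem, one coordinate at a time. *)
Lemma integral_tuple_prod d (T : measurableType d) (R : realType)
    (mu : {sigma_finite_measure set T -> \bar R}) n (g : 'I_n -> T -> R)
    (c : 'I_n -> R) :
  (forall i, measurable_fun setT (g i)) -> (forall i x, 0 <= g i x) ->
  (forall i, \int[mu]_x (g i x)%:E = (c i)%:E)%E ->
  (\int[tuple_measure mu n]_t (\prod_(i < n) g i (tnth t i))%:E
    = (\prod_(i < n) c i)%:E)%E.
Proof.
elim: n g c => [|n IH] g c mg g0 gc.
  rewrite big_ord0.
  rewrite [LHS](@integral_dirac _ (0.-tuple T) [tuple] R setT)//; last first.
    by apply/measurable_EFinP; exact: measurable_tuple_prod.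
  by rewrite big_ord0 diracT mul1e.
have mG : measurable_fun [set: n.+1.-tuple T]
    (fun t => (\prod_(i < n.+1) g i (tnth t i))%:E).
  by apply/measurable_EFinP; exact: measurable_tuple_prod.
have prod0 m (h : 'I_m -> T -> R) (t : m.-tuple T) : (forall i x, 0 <= h i x) ->
  (0 <= (\prod_(i < m) h i (tnth t i))%:E)%E.
  by move=> h0; rewrite lee_fin prodr_ge0.
rewrite [LHS](@ge0_integral_pushforward _ _ _ _ _ _
   (@measurable_tuple_cons _ T n)
   (mu \x tuple_measure mu n)%E)//; last by move=> t _; exact: prod0.
rewrite preimage_setT fubini_tonelli1//=; last 2 first.
  apply: measurableT_comp mG _; exact: measurable_tuple_cons.
  move=> p; exact: prod0.
have consE x (t : n.-tuple T) :
    \prod_(i < n.+1) g i (tnth (tuple_cons (x, t)) i) =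
    g ord0 x * \prod_(i < n) g (lift ord0 i) (tnth t i).
  rewrite big_ord_recl tnth0; congr (_ * _); apply: eq_bigr => i _.
  by rewrite tnthS.
rewrite /fubini_F /=.
under eq_integral => x _.
  under eq_integral do rewrite consE EFinM.
  rewrite ge0_integralZl//; last first.
  - by rewrite lee_fin.
  - by move=> t _; apply: (prod0 _ (fun i => g (lift ord0 i))).
  - apply/measurable_EFinP.
    exact: (@measurable_tuple_prod _ _ _ _ (fun i => g (lift ord0 i))).
  rewrite (IH (fun i => g (lift ord0 i)) (fun i => c (lift ord0 i)))//.
  over.
rewrite ge0_integralZr//.
- by rewrite gc big_ord_recl EFinM.
- by apply/measurable_EFinP.
- by move=> x _; rewrite lee_fin.
- rewrite lee_fin prodr_ge0// => i _.
  rewrite -lee_fin -gc integral_ge0// => x _.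
  by rewrite lee_fin.
Qed.

Lemma integral_exprn01 (R : realType) n :
  (\int[lebesgue_measure]_(x in `[0%R, 1%R]) (x ^+ n)%:E =
    (n.+1%:R^-1 : R)%:E)%E.
Proof.
rewrite (@continuous_FTC2 _ _ (fun x => x ^+ n.+1 / n.+1%:R))//=.
- by rewrite expr1n expr0n/= mul0r mul1r oppr0 adde0.
- by apply: continuous_in_subspaceT => x _; exact: exprn_continuous.
- split => [x _||].
  + by apply: derivableM => //=; exact: exprn_derivable.
  + apply: cvgM; last exact: cvg_cst.
    by apply: cvg_at_right_filter; exact: exprn_continuous.
  + apply: cvgM; last exact: cvg_cst.
    by apply: cvg_at_left_filter; exact: exprn_continuous.
- move=> x _; rewrite derive1Mr; last exact: exprn_derivable.
  by rewrite exp_derive1 /= mulrAC -mulr_natl mulfV// mul1r.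
Qed.

(** Extended by zero off the cube, a monomial is the product of the functions
[g i], each extending a power by zero off [0, 1]; this turns an integral over
the cube into one over the whole space of tuples. *)
Lemma cube_integral_monomial (R : realType) d (a : R) (e : 'I_d -> nat) :
  0 <= a ->
  cube_integral (fun x : 'rV[R]_d => a * \prod_i x ord0 i ^+ e i) =
  a * \prod_i (e i).+1%:R^-1.
Proof.
move=> a0; pose g i : R -> R := (fun x : R => x ^+ e i) \_ `[0, 1].
have mg i : measurable_fun [set: measurableTypeR R] (g i).
  apply: (@measurable_restrictT _ _ (measurableTypeR R) _ `[0, 1]
    (fun x : measurableTypeR R => x ^+ e i) _).1; first exact: measurable_itv.
  exact: exprn_measurable.
have g0 i x : 0 <= g i x.
  rewrite /g patchE; case: ifPn => // /set_mem /=.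
  by rewrite in_itv/= => /andP[x0 _]; exact: exprn_ge0.
have gP (t : d.-tuple (measurableTypeR R)) :
    (((fun t => a * \prod_i (row_of_tuple t) ord0 i ^+ e i) \_
      (@row_of_tuple R d @^-1` @unit_cube R d)) t) =
    a * \prod_i g i (tnth t i).
  rewrite patchE; case: ifPn => [|tC].
    rewrite inE => tC; congr (_ * _); apply: eq_bigr => i _.
    by rewrite mxE /g patchE mem_set//; have := tC i; rewrite mxE.
  have /existsP[i ti] : [exists i, tnth t i \notin `[0%R, 1%R]].
    apply: contraNT tC => /existsPn h; rewrite inE => i.
    by rewrite mxE; have := h i; rewrite negbK.
  rewrite (bigD1 i)//= /g patchE memNset ?mul0r ?mulr0// => ti'.
  by rewrite ti' in ti.
rewrite /cube_integral /Rintegral integral_mkcond.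
under eq_integral do rewrite restrict_EFin /comp gP EFinM.
rewrite ge0_integralZl//; last 2 first.
- by apply/measurable_EFinP; exact: measurable_tuple_prod.
- by move=> t _; rewrite lee_fin prodr_ge0.
rewrite [X in (_ * X)%E](@integral_tuple_prod _ (measurableTypeR R) _
  (@lebesgue_measure R) d g (fun i => (e i).+1%:R^-1))//.
move=> i; rewrite -integral_exprn01 [in RHS]integral_mkcond.
by apply: eq_integral => x _; rewrite restrict_EFin.
Qed.

(** * Products of two coordinates belong to the unit ball *)

(** Through a point of the cube, one of the two directions along each axis stays
in the cube for increments up to 1/2. Properness makes the limit that defines
the partial derivative unique. *)
Lemma increments_proper (R : realType) d (i : 'I_d) (x : 'rV[R]_d) :
  unit_cube x -> ProperFilter (increments i x).
Proof.
move=> xC; apply: Build_ProperFilter_ex => P.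
rewrite /increments /within /= /dnbhs /within /= => /nbhs_ballP[r /= r0 rP].
have [xi0 xi1] : 0 <= x ord0 i /\ x ord0 i <= 1.
  by have := xC i; rewrite in_itv/= => /andP[].
pose m := Num.min (r / 2) (1 / 2).
have [m0 mr m1] : [/\ 0 < m, m < r & m <= 1 / 2].
  rewrite /m; split; first by rewrite lt_min; apply/andP; split; lra.
    by rewrite gt_min; apply/orP; left; lra.
  by rewrite ge_min lexx orbT.
(* Move towards the farther of the two faces orthogonal to the i-th axis. *)
pose h := if x ord0 i <= 1 / 2 then m else - m.
exists h; apply: rP.
- rewrite /ball/= sub0r normrN /h; case: ifP => _; rewrite ?normrN gtr0_norm//.
- by rewrite /h; case: ifP => _; rewrite ?oppr_eq0 gt_eqF.
- move=> k; rewrite !mxE eqxx /=; have [->|ki] := eqVneq k i.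
    rewrite mulr1 in_itv/= /h; case: ifPn => xi.
      by apply/andP; split; lra.
    by rewrite -ltNge in xi; apply/andP; split; lra.
  by rewrite mulr0 addr0; exact: xC.
Qed.

Lemma cvg_difference_quotient (R : realType) d (i : 'I_d) (f : 'rV[R]_d -> R)
    (x : 'rV[R]_d) (g k : R) :
  unit_cube x ->
  (forall h, unit_cube (x + h *: delta_mx ord0 i) ->
    f (x + h *: delta_mx ord0 i) = f x + h * g + h ^+ 2 * k) ->
  difference_quotient i f x @ increments i x --> g.
Proof.
move=> xC fE.
have lin : (fun h : R => g + h * k) @ increments i x --> g.
  apply: cvg_within_filter; apply: cvg_within_filter.
  have : (fun h : R => g + h * k) @ (0 : R) --> g + 0 * k.
    apply: cvgD; first exact: cvg_cst.
    by apply: cvgM; [exact: cvg_id|exact: cvg_cst].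
  by rewrite mul0r addr0.
apply: cvg_trans lin; apply: near_eq_cvg.
rewrite /increments near_withinE near_withinE; near=> h => h0 hC.
by rewrite /difference_quotient fE//; field.
Unshelve. all: by end_near.
Qed.

(** [iter_partial] iterates on functions whose values off the cube are
meaningless. A family [D] of continuous functions indexed by lists of
directions and linked by Taylor expansions of order two, which are exact for
polynomials of degree at most two, identifies all iterated partial derivatives
of [D [::]] on the cube at once. *)
Section expansion.
Variables (R : realType) (d : nat) (D : seq 'I_d -> 'rV[R]_d -> R).
Hypothesis D_cont : forall s, continuous (D s).
Hypothesis D_expand : forall s i x h, D s (x + h *: delta_mx ord0 i) =
  D s x + h * D (i :: s) x + h ^+ 2 * (D [:: i, i & s] x / 2).

Lemma iter_partial_expansion s x :
  unit_cube x -> iter_partial s (D [::]) x = D s x.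
Proof.
elim: s x => //= i s IH x xC.
have PF := increments_proper i xC.
apply: cvg_lim => //.
apply: (cvg_difference_quotient (k := D [:: i, i & s] x / 2)) => // h hC.
by rewrite !IH// D_expand.
Qed.

Lemma unit_ball_expansion :
  (forall s x, unit_cube x -> `|D s x| <= 1) -> unit_ball (D [::]).
Proof.
move=> D1; split.
- move=> s; split.
    apply: (@subspace_eq_continuous _ _ _ (D s)).
      by move=> x /set_mem xC; rewrite /from_subspace iter_partial_expansion.
    by apply: continuous_subspaceT; exact: D_cont.
  move=> i x xC; apply/cvg_ex; exists (D (i :: s) x).
  apply: (cvg_difference_quotient (k := D [:: i, i & s] x / 2)) => // h hC.
  by rewrite !iter_partial_expansion// D_expand.
- apply: ge_ereal_sup => _ [alpha _ [x xC <-]].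
  by rewrite lee_fin /multi_partial iter_partial_expansion// D1.
Qed.
End expansion.

(** The iterated partial derivative of [x_i * x_k / 2] in the directions listed
in [s], in closed form on the whole space. *)
Definition half_product_derivative (R : realType) d (i k : 'I_d)
    (s : seq 'I_d) (x : 'rV[R]_d) : R :=
  match s with
  | [::] => x ord0 i * x ord0 k / 2
  | [:: l] => ((l == i)%:R * x ord0 k + (l == k)%:R * x ord0 i) / 2
  | [:: l; m] => (((l == i) && (m == k))%:R + ((l == k) && (m == i))%:R) / 2
  | _ => 0
  end.

(** The factor 1/2 is forced by the case [i = k], where the first derivative of
[x_i ^+ 2] reaches 2. *)
Lemma unit_ball_half_product (R : realType) d (i k : 'I_d) :
  unit_ball (fun x : 'rV[R]_d => x ord0 i * x ord0 k / 2).
Proof.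
apply: (@unit_ball_expansion _ _ (half_product_derivative i k)).
- have coord j : continuous (fun x : 'rV[R]_d => x ord0 j).
    exact: coord_continuous.
  have cst (c : R) : continuous (fun _ : 'rV[R]_d => c).
    by move=> x; exact: cst_continuous.
  have mul (f g : 'rV[R]_d -> R) :
      continuous f -> continuous g -> continuous (fun x => f x * g x).
    by move=> cf cg x; exact: (@continuousM _ _ f g x (cf x) (cg x)).
  have add (f g : 'rV[R]_d -> R) :
      continuous f -> continuous g -> continuous (fun x => f x + g x).
    by move=> cf cg x; exact: (@continuousD _ _ _ f g x (cf x) (cg x)).
  move=> [|l [|m [|? ?]]]; rewrite /half_product_derivative.
  + exact: (mul _ _ (mul _ _ (coord i) (coord k)) (cst _)).
  + exact: (mul _ _ (add _ _ (mul _ _ (cst _) (coord k))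
      (mul _ _ (cst _) (coord i))) (cst _)).
  + exact: cst.
  + exact: cst.
- move=> [|l [|m [|? ?]]] j x h /=.
  + rewrite !mxE !eqxx /= (eq_sym i) (eq_sym k).
    by case: (j == i); case: (j == k) => /=; field.
  + rewrite !mxE !eqxx /= (eq_sym i) (eq_sym k).
    case: (j == i); case: (j == k); case: (l == i); case: (l == k) => /=;
      by field.
  + by rewrite !mulr0 mul0r mulr0 !addr0.
  + by rewrite !mulr0 mul0r mulr0 !addr0.
- move=> s x xC.
  have x01 j : 0 <= x ord0 j <= 1 by have := xC j; rewrite in_itv.
  have /andP[i0 i1] := x01 i; have /andP[k0 k1] := x01 k.
  have [p0 p1] : 0 <= x ord0 i * x ord0 k /\ x ord0 i * x ord0 k <= 1.
    by split; [exact: mulr_ge0|exact: mulr_ile1].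
  rewrite ler_norml; case: s => [|l [|m [|? ?]]] /=.
  + by apply/andP; split; lra.
  + by case: (l == i); case: (l == k); apply/andP; split => /=; lra.
  + case: (l == i); case: (m == k); case: (l == k); case: (m == i);
      by apply/andP; split => /=; lra.
  + by apply/andP; split; lra.
Qed.

(** * Second moments seen by a linear algorithm *)

Lemma cube_integral_half_product (R : realType) d (i k : 'I_d) :
  cube_integral (fun x : 'rV[R]_d => x ord0 i * x ord0 k / 2) =
  (if i == k then 1 / 3 else 1 / 4) / 2.
Proof.
pose e j := ((j == i) + (j == k))%N.
have -> : (fun x : 'rV[R]_d => x ord0 i * x ord0 k / 2) =
    (fun x => 2^-1 * \prod_j x ord0 j ^+ e j).
  apply/funext => x; rewrite mulrC; congr (_ * _).
  under eq_bigr do rewrite exprD.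
  rewrite big_split /=; congr (_ * _).
  - by rewrite (bigD1 i)//= eqxx big1 ?mulr1// => j /negbTE ->.
  - by rewrite (bigD1 k)//= eqxx big1 ?mulr1// => j /negbTE ->.
rewrite cube_integral_monomial ?invr_ge0// mulrC; congr (_ / 2).
rewrite (bigD1 i)//= /e eqxx; have [<-|ik] := eqVneq i k.
  by rewrite big1 => [|j /negbTE ->]; rewrite ?invr1//=; field.
rewrite (bigD1 k) 1?eq_sym//= eqxx (negbTE ik) big1 => [|j /andP[]] /=.
  by field.
by move=> /negbTE -> /negbTE ->; rewrite invr1.
Qed.

Lemma second_moment_error (R : realType) d n (a : 'I_n -> R)
    (x : 'I_n -> 'rV[R]_d) (eps : R) :
  (worst_case_error (linear_algorithm a x) <= eps%:E)%E ->
  forall i k, `|(if i == k then 1 / 3 else 1 / 4)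
    - \sum_j a j * (x j ord0 i * x j ord0 k)| <= 2 * eps.
Proof.
move=> err i k; have := unit_ball_half_product R i k.
set f := fun _ => _ => fB.
have : (`|cube_integral f - linear_algorithm a x f|%:E <= eps%:E)%E.
  by apply: le_trans err; apply: ereal_sup_ubound; exists f.
rewrite lee_fin cube_integral_half_product /linear_algorithm /f.
under eq_bigr do rewrite mulrA; rewrite -mulr_suml -mulrBl normrM.
by rewrite normfV (ger0_norm (ler0n _ 2)) ler_pdivrMr ?ltr0n// (mulrC eps).
Qed.

Lemma complexity_le_attained (R : realType) (eps c : R) d :
  (complexity eps d <= c%:E)%E ->
  exists n (a : 'I_n -> R) (x : 'I_n -> 'rV[R]_d),
    (n <= Num.truncn c)%N /\
    (worst_case_error (linear_algorithm a x) <= eps%:E)%E.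
Proof.
move=> cle; have : (complexity eps d < (Num.truncn c).+1%:R%:E)%E.
  by apply: le_lt_trans cle _; rewrite lte_fin truncnS_gt.
move=> /ereal_inf_lt[_ [n [a [x [_ err]]] <-]].
by rewrite lte_fin ltr_nat ltnS => nc; exists n, a, x.
Qed.

Theorem mainTheorem2 (R : realType) : ~ strongly_tractable R.
Proof.
move=> [p Hp].
pose eps : R := 1 / 96.
set N := Num.truncn p.[eps^-1].
have [K HK] := @near_equal_rows R N 1 (1 / 48) ltac:(lra).
have eps01 : 0 < eps < 1 by rewrite /eps; apply/andP; split; lra.
have [n [a [x [nN err]]]] :=
  complexity_le_attained (Hp eps K.+1 eps01 isT).
pose M : 'M[R]_K.+1 := \matrix_(i, k) \sum_j a j * (x j ord0 i * x j ord0 k).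
have mom i k : `|(if i == k then 1 / 3 else 1 / 4) - M i k| <= 1 / 48.
  have := second_moment_error err i k; rewrite mxE.
  by move/le_trans; apply; rewrite /eps; clear; lra.
have rM : (\rank M <= N)%N.
  apply: leq_trans nN.
  have -> : M = (\matrix_(i, j) (a j * x j ord0 i))
                *m (\matrix_(j, k) x j ord0 k).
    apply/matrixP => i k; rewrite !mxE.
    by apply: eq_bigr => j _; rewrite !mxE mulrA.
  by apply: leq_trans (mxrankM_maxl _ _) _; exact: rank_leq_col.
clear Hp err.
have MB i k : `|M i k| <= 1.
  have := mom i k; rewrite !ler_norml => /andP[m1 m2].
  by apply/andP; move: m1 m2; case: (i == k) => m1 m2; split; lra.
have [|i [j [_ _ ij /(_ i)]]] := HK _ _ M [set: _]%SET rM MB.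
  by rewrite cardsT card_ord.
(* In column i the two rows differ by at least 1/3 - 1/4 - 2/48 = 1/24. *)
have := mom i i; have := mom j i.
rewrite eqxx eq_sym (negbTE ij) !ler_norml.
move=> /andP[m1 m2] /andP[m3 m4] /andP[m5 m6]; lra.
Qed.
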